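(* Let $M$ be the torus and suppose a $2,\!4$-hexangulation of $M$ is given, i.e. a map on $M$ all of whose faces are hexagons, in which every vertex has degree $3$ except for exactly two vertices, one of degree $2$ and one of degree $4$. Then the vertices of this hexangulation cannot be $2$-colored so that adjacent vertices receive different colors; that is, its $1$-skeleton is not bipartite.
   Context: A map on a closed connected surface $M$ is an embedding of a finite graph $G$ in $M$ such that every face (connected component of $M\smallsetminus G$) is an open disk. Here a graph is a one-dimensional cell complex, so loops and multiple edges are allowed. A face is a $k$-gon if its boundary walk has $k$ edges (counted with multiplicity). A hexangulation is a map all of whose faces are hexagons. The degree of a vertex counts edge-ends (a loop contributes $2$). *)

(* Defs.v *)
(* Maps on orientable surfaces as combinatorial maps
   (rotation systems, Heffter--Edmonds).  *)
From mathcomp Require Import all_boot.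
Set Implicit Arguments. Unset Strict Implicit. Unset Printing Implicit Defensive.

(* An oriented combinatorial map on the finite dart set D:
   - [alpha] : fixed-point-free involution (the two darts = half-edges of an edge),
   - [sigma] : permutation (cyclic rotation of darts around each vertex),
   - the group <alpha, sigma> acts transitively (the underlying graph / surface
     is connected).
   Vertices = sigma-orbits, edges = alpha-orbits, faces = orbits of
   [face_perm] = sigma \o alpha (the face boundary walk). *)
Record cmap (D : finType) := CMap {
  alpha : D -> D;
  sigma : D -> D;
  alpha_invol : involutive alpha;
  alpha_nofix : forall x, alpha x != x;
  sigma_inj : injective sigma;
  cmap_conn : forall x y : D,
      connect (fun a b => (b == sigma a) || (b == alpha a)) x y
}.

Definition face_perm D (m : cmap D) : D -> D := fun x => sigma m (alpha m x).

Definition nverts D (m : cmap D) := fcard (sigma m) D.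
Definition nfaces D (m : cmap D) := fcard (face_perm m) D.

(* The closed orientable surface of the map has Euler characteristic
   V - E + F; it is the torus iff V - E + F = 0, i.e. 2 (V + F) = #|D|. *)
Definition on_torus D (m : cmap D) : Prop :=
  (2 * (nverts m + nfaces m) = #|D|)%N.

(* degree of the vertex containing dart x (a loop contributes 2) *)
Definition vdeg D (m : cmap D) (x : D) := order (sigma m) x.
Definition flen D (m : cmap D) (x : D) := order (face_perm m) x.

Definition hexangulation D (m : cmap D) : Prop := forall x, flen m x = 6.

Definition deg_2_4 D (m : cmap D) : Prop :=
  exists v2 v4 : D, [/\ vdeg m v2 = 2, vdeg m v4 = 4 &
    forall x, vdeg m x = 3 \/ fconnect (sigma m) v2 x \/ fconnect (sigma m) v4 x].

Definition bipartite D (m : cmap D) : Prop :=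
  exists c : D -> bool,
    (forall x, c (sigma m x) = c x) /\ (forall x, c (alpha m x) != c x).

(* Main.v *)
Require Import Defs.
From mathcomp Require Import all_boot zify.
Set Implicit Arguments. Unset Strict Implicit. Unset Printing Implicit Defensive.

(** If the hexangulation is 2-coloured, counting edges modulo 3 shows that the
vertices p of degree 2 and q of degree 4 have the same colour, say black.  The
black vertices then span a triangulation with one triangle around each white
vertex and one inside each hexagon; its edges, directed so as to have the white
vertex on their left, develop onto the edges of the regular triangular lattice
directed along 1, w and w^2, and the holonomy is generated by rotations by 120
degrees.  The gauge of an equilateral triangle is invariant under these
rotations, so that the set {p, q} has a triangular-distance Delaunay
triangulation: from each of the six edges leaving p or q one grows an
equilateral triangle with that corner until its far side meets p or q.  These
six segments cut the surface into four triangles, each inscribed in an immersed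
equilateral triangle, and the coordinates of the segments satisfy linear
equations expressing that the triangles close up.  There are finitely many ways
to fit four triangles around a vertex with 2 and a vertex with 4 outgoing
sectors, and in each of them the equations have no positive solution. *)

(** * Orbits of a permutation *)

Section Orders.
Variables (T : finType) (f : T -> T).
Hypothesis f_inj : injective f.

(** The set is the orbit of [v] plus whole orbits of length [n]; this counts the darts of one colour
    modulo 3. *)
Lemma card_closed_order (A : {pred T}) v n : fclosed f A -> v \in A ->
  (forall x, x \in A -> fconnect f v x \/ order f x = n) ->
  exists k, #|A| = order f v + k * n.
Proof.
move=> clA vA oA; exists (fcard f [predD A & fconnect f v]).
have conn_sym := fconnect_sym f_inj.
rewrite -(cardID (fconnect f v) A); congr (_ + _).
  apply: eq_card => x; rewrite !inE; case vx: (fconnect f v x); rewrite ?andbF //.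
  by rewrite -(closed_connect clA vx) vA.
rewrite (@fcard_order_set _ _ f_inj n).
- by apply: eq_card => x; rewrite !inE andbC.
- apply/subsetP => x; rewrite !inE => /andP[nvx xA].
  by case: (oA x xA) => [vx|->] //; rewrite vx in nvx.
move=> x y xy; rewrite !inE -(clA _ _ xy); congr (~~ _ && _).
by apply: same_connect_r => //; apply: connect1.
Qed.

Lemma order_fix x : f x = x -> order f x <= 1.
Proof. by move=> e; apply: (@order_le_cycle _ _ [:: x]); rewrite /= ?e ?eqxx ?inE. Qed.

Lemma order_fix2 x : f (f x) = x -> order f x <= 2.
Proof. by move=> e; apply: (@order_le_cycle _ _ [:: x; f x]); rewrite /= ?e ?eqxx ?inE ?eqxx. Qed.
End Orders.

Lemma finite_choice T (t0 : T) (P : nat -> T -> Prop) n :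
  (forall x, x < n -> exists t, P x t) -> exists f, forall x, x < n -> P x (f x).
Proof.
elim: n => [|n IH] ex; first by exists (fun=> t0).
have [|f fP] := IH; first by move=> x xn; apply: ex; apply: ltnW.
have [t tP] := ex n (ltnSn n).
exists (fun x => if x == n then t else f x) => x xn; case: eqP => [->//|xneq].
by apply: fP; lia.
Qed.

(** * Gluing patterns of four triangles *)

(* The six segments are numbered by their tails: 0 and 1 start at p, 2 to 5 at
   q, counterclockwise.  Segment [e] has the dart [e] at its tail and the dart
   [e + 6] at its head.  The table [N] lists the values found so far of the
   counterclockwise successor on darts, any value from 12 on meaning unknown. *)
Definition next_out e := nth 0 [:: 1; 0; 3; 4; 5; 2] e.
Definition rev_dart x := if x < 6 then x + 6 else x - 6.

Definition get (N : seq nat) x := nth 12 N x.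
Definition step N x := let y := get N x in if y < 12 then rev_dart y else 12.

(* Between two consecutive outgoing darts there are only incoming ones.  At most
   six of these can occur, hence the depth 7 below. *)
Fixpoint walk_ok n N e x :=
  if n is n'.+1 then
    let y := get N x in
    if y < 6 then y == next_out e else if y < 12 then walk_ok n' N e y else true
  else true.
Definition cycle_ok N x :=
  let y := step N x in
  if y == x then false
  else let z := step N (step N y) in if z < 12 then z == x else true.
Definition consistent N :=
  if all (cycle_ok N) (iota 0 12) then all (fun e => walk_ok 7 N e e) (iota 0 6) else false.

Fixpoint walk_end n N x :=
  if n is n'.+1 then
    let y := get N x in if y < 6 then 12 else if y < 12 then walk_end n' N y else x
  else 12.
Definition unknown N x := if x < 12 then 12 <= get N x else false.
(** Two known steps lead from such a [z] to a dart with unknown successor; faces being triangles,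
    the third step returns to [z]. *)
Definition forced N := [seq z <- iota 0 12 | unknown N (step N (step N z))].
Definition open_darts N :=
  [seq x <- [seq walk_end 7 N e | e <- iota 0 6] ++ iota 0 12 | unknown N x].
Definition unused (N : seq nat) := [seq y <- iota 0 12 | y \notin N].
Definition branches N :=
  if forced N is z :: _ then Some (step N (step N z), [:: rev_dart z])
  else if open_darts N is x :: _ then Some (x, unused N) else None.

(* A segment has lattice coordinates [i] and [j] with respect to its sector;
   variable [k < 6] stands for [i k] and [k + 6] for [j k].  The side of the
   triangle filling the corner between a dart and its successor is the sum of
   the [c_terms] of the former and the [d_terms] of the latter. *)
Definition c_terms x := if x < 6 then [:: x; x + 6] else [:: x - 6].
Definition d_terms x := if x < 6 then [:: x; x + 6] else [:: x].
(* Equality of the sides computed at two corners of a face, with the common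
   term cancelled. *)
Definition relation N x :=
  let y := get N x in
  if y < 6 then (y + 6 :: c_terms x, d_terms (get N (y + 6)))
  else (y - 6 :: d_terms (get N (y - 6)), c_terms x).

(** Strictness is asked among the first six variables because only the [i] are known to be
    positive. *)
Definition absurd (a b : seq nat) :=
  if all (fun k => nth 0 b k <= nth 0 a k) (iota 0 12)
  then has (fun k => nth 0 b k < nth 0 a k) (iota 0 6) else false.

(* Looks for a set of relations whose sum has a left-hand side exceeding the
   right-hand side. *)
Fixpoint refute rows a b :=
  if absurd a b then true else
  if rows is (l, r) :: rows' then
    if refute rows' (foldl incr_nth a l) (foldl incr_nth b r) then true
    else refute rows' a b
  else false.

Definition refuted N := refute [seq relation N x | x <- iota 0 12] [::] [::].

Fixpoint search n N :=
  if consistent N then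
    if branches N is Some (x, ys) then
      if n is n'.+1 then all (fun y => search n' (set_nth 12 N x y)) ys else false
    else refuted N
  else true.

(** Each branching fills one more of the 12 entries, hence the bound 12. *)
Lemma search_nil : search 12 [::] = true.
Proof. vm_cast_no_check (erefl true). Qed.

(** * Soundness of the search *)

(* [nx] is the successor on darts, [sec x] the last outgoing dart not after [x],
   and [G] runs around the faces. *)
Section DartSystem.
Variables (nx sec i j : nat -> nat).
Let c x := if x < 6 then i x + j x else i (x - 6).
Let d x := if x < 6 then i x + j x else j (x - 6).
Let G x := rev_dart (nx x).
Hypothesis nx_lt : forall x, x < 12 -> nx x < 12.
Hypothesis sec_out : forall e, e < 6 -> sec e = e.
Hypothesis nx_out : forall x, x < 12 -> nx x < 6 -> nx x = next_out (sec x).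
Hypothesis nx_in : forall x, x < 12 -> 6 <= nx x -> sec (nx x) = sec x.
Hypothesis G3 : forall x, x < 12 -> G (G (G x)) = x.
Hypothesis G_neq : forall x, x < 12 -> G x != x.
Hypothesis i_gt0 : forall e, e < 6 -> 0 < i e.
Hypothesis G_size : forall x, x < 12 -> c x + d (nx x) = c (G x) + d (nx (G x)).

Let rev_lt x : x < 12 -> rev_dart x < 12.
Proof. by rewrite /rev_dart => xl; case: ifP; lia. Qed.
Let revK x : x < 12 -> rev_dart (rev_dart x) = x.
Proof. by rewrite /rev_dart => xl; case: (ltnP x 6) => x6; case: ifP; lia. Qed.
Let G_lt x : x < 12 -> G x < 12.
Proof. by move=> /nx_lt/rev_lt. Qed.
Let G_inj x y : x < 12 -> y < 12 -> G x = G y -> x = y.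
Proof. by move=> xl yl e; rewrite -(G3 xl) -(G3 yl) e. Qed.

Let agrees N := forall x, get N x < 12 -> x < 12 /\ get N x = nx x.

Let step_agrees N x : agrees N -> step N x < 12 -> x < 12 /\ step N x = G x.
Proof. by rewrite /step => ag; case: ifP => // /ag[xl ->]. Qed.

Let walk_agrees N n e x : agrees N -> x < 12 -> sec x = e -> walk_ok n N e x.
Proof.
move=> ag; elim: n x => //= n IH x xl sx; case: ifP => [yl|yg].
  have [_ yE] : x < 12 /\ get N x = nx x by apply: ag; lia.
  by rewrite yE nx_out ?sx -?yE.
case: ifP => // yl; have [_ yE] := ag _ yl; apply: IH => //.
by rewrite yE nx_in // -yE leqNgt yg.
Qed.

Let consistent_agrees N : agrees N -> consistent N.
Proof.
move=> ag; rewrite /consistent; case: ifP => [_|/negP[]].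
  apply/allP => e; rewrite mem_iota => /andP[_ el].
  by apply: walk_agrees => //; [lia | apply: sec_out].
apply/allP => x; rewrite mem_iota => /andP[_ xl]; rewrite /cycle_ok.
case: ifP => [/eqP sx|_].
  have [_ sG] : x < 12 /\ step N x = G x by apply: step_agrees; rewrite ?sx.
  by have := G_neq xl; rewrite -sG sx eqxx.
case: ifP => // zl; have [yl zE] := step_agrees ag zl.
have [wl yE] := step_agrees ag yl; have [_ wE] := step_agrees ag wl.
by rewrite zE yE wE G3.
Qed.

Let branches_agrees N x ys : agrees N -> branches N = Some (x, ys) ->
  x < 12 /\ nx x \in ys.
Proof.
rewrite /branches => ag; case E : (forced N) => [|z s].
  case E' : (open_darts N) => [|x' s'] // [<- <-].
  have : x' \in open_darts N by rewrite E' mem_head.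
  rewrite mem_filter /unknown => /andP[]; case: ifP => // xl xu _; split=> //.
  rewrite mem_filter mem_iota nx_lt //= andbT; apply/negP => /(nthP 12)[k kN kE].
  have [kl kE'] : k < 12 /\ get N k = nx k by apply: ag; rewrite /get kE nx_lt.
  have kx : k = x' by apply: G_inj => //; rewrite /G -kE' /get kE.
  by move: xu; rewrite -kx /get kE leqNgt nx_lt // kx.
move=> [<- <-].
have : z \in forced N by rewrite E mem_head.
rewrite mem_filter /unknown => /andP[]; case: ifP => // xl _ _.
have [yl xE] := step_agrees ag xl; have [zl yE] := step_agrees ag yl.
split=> //; rewrite inE; apply/eqP; rewrite -[LHS]revK ?nx_lt // -/(G _).
by rewrite xE yE G3.
Qed.

Let branches_none N x : agrees N -> branches N = None -> x < 12 -> get N x = nx x.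
Proof.
rewrite /branches => ag; case: (forced N) => //; case E : (open_darts N) => [|//] _ xl.
have : x \notin open_darts N by rewrite E.
rewrite mem_filter mem_cat mem_iota /= add0n xl orbT andbT /unknown xl -ltnNge.
by case/ag.
Qed.

Let v k := if k < 6 then i k else j (k - 6).
Let value l := sumn (map v l).
Let small l := all (fun k => k < 12) l.

Let c_termsE x : x < 12 -> value (c_terms x) = c x /\ small (c_terms x).
Proof.
rewrite /value /c_terms /c /v => xl; case: ifP => x6 /=; rewrite ?x6 ?addn0.
  by split; [rewrite ifF ?addnK; lia | rewrite /small /= !andbT; lia].
by split; [rewrite ifT; lia | rewrite /small /= !andbT; lia].
Qed.

Let d_termsE x : x < 12 -> value (d_terms x) = d x /\ small (d_terms x).
Proof.
rewrite /value /d_terms /d /v => xl; case: ifP => x6 /=; rewrite ?x6 ?addn0.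
  by split; [rewrite ifF ?addnK; lia | rewrite /small /= !andbT; lia].
by split; rewrite // /small /= andbT.
Qed.

Let relationE N x : (forall y, y < 12 -> get N y = nx y) -> x < 12 ->
  [/\ small (relation N x).1, small (relation N x).2 &
      value (relation N x).1 = value (relation N x).2].
Proof.
move=> ag xl; rewrite /relation ag //; have yl := nx_lt xl.
have := G_size xl; rewrite /G /rev_dart.
have [cv cs] := c_termsE xl.
case: ifP => y6 /= e.
  have zl : nx x + 6 < 12 by lia.
  have [dv ds] := d_termsE (nx_lt zl).
  rewrite ag //; split; rewrite ?dv //.
    by rewrite /small /= -/(small _) cs zl.
  rewrite /value /= -/(value _) cv.
  have n6 : nx x + 6 < 6 = false by lia.
  have dE : d (nx x) = i (nx x) + j (nx x) by rewrite /d y6.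
  have cE : c (nx x + 6) = i (nx x) by rewrite /c n6 addnK.
  by rewrite /v n6 addnK; lia.
have zl : nx x - 6 < 12 by lia.
have [dv ds] := d_termsE (nx_lt zl).
rewrite ag //; split; rewrite ?cv //.
  by rewrite /small /= -/(small _) ds zl.
rewrite /value /= -/(value _) dv.
have z6 : nx x - 6 < 6 by lia.
have dE : d (nx x) = j (nx x - 6) by rewrite /d y6.
have cE : c (nx x - 6) = i (nx x - 6) + j (nx x - 6) by rewrite /c z6.
by rewrite /v z6; lia.
Qed.

Let dot a := \sum_(k < 12) nth 0 a k * v k.

Let dot_incr a k : k < 12 -> dot (incr_nth a k) = v k + dot a.
Proof.
move=> kl; rewrite /dot.
under eq_bigr => l _ do rewrite nth_incr_nth mulnDl.
rewrite big_split /=; congr (_ + _).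
rewrite (bigD1 (Ordinal kl)) //= eqxx mul1n big1 ?addn0 // => l ne.
case: eqP => // kE; case/eqP: ne; exact: val_inj.
Qed.

Let dot_foldl a l : small l -> dot (foldl incr_nth a l) = value l + dot a.
Proof.
rewrite /value; elim: l a => //= k l IH a /andP[kl sl].
by rewrite IH // dot_incr // addnCA addnA.
Qed.

Let absurd_dot a b : absurd a b -> dot a <> dot b.
Proof.
rewrite /absurd; case: ifP => // /allP le /hasP[k]; rewrite mem_iota => /andP[_ k6] lt.
have kl : k < 12 by lia.
suff : dot b < dot a by lia.
rewrite /dot (bigD1 (Ordinal kl)) //= [X in _ < X](bigD1 (Ordinal kl)) //=.
rewrite -addSn leq_add //.
  by rewrite ltn_mul2r lt andbT /v k6 i_gt0.
by apply: leq_sum => l _; rewrite leq_mul2r le ?orbT // mem_iota /=.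
Qed.

Let refute_sound rows a b :
  (forall r, r \in rows -> [/\ small r.1, small r.2 & value r.1 = value r.2]) ->
  dot a = dot b -> refute rows a b -> False.
Proof.
elim: rows a b => [|[l r] rows IH] a b rs e /=; first by case: ifP => // /absurd_dot.
case: ifP => [/absurd_dot//|_].
have rs' r' : r' \in rows -> [/\ small r'.1, small r'.2 & value r'.1 = value r'.2].
  by move=> r'in; apply: rs; rewrite inE r'in orbT.
have [sl sr /= lr] := rs (l, r) (mem_head _ _).
case: ifP => [H _|_]; last exact: IH.
by apply: IH H => //; rewrite !dot_foldl // lr e.
Qed.

(** The branch following the true [nx] keeps [agrees], down to a full table whose relations hold for
    [i] and [j]. *)
Let search_sound n N : agrees N -> search n N -> False.
Proof.
elim: n N => [|n IH] N ag /=; rewrite (consistent_agrees ag).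
all: case E: (branches N) => [[x ys]|] //.
2: have [xl xy] := branches_agrees ag E; move=> /allP/(_ _ xy); apply: IH => z;
   by rewrite /get nth_set_nth /=; case: eqP => [-> // | _]; apply: ag.
all: apply: refute_sound => // r /mapP[x]; rewrite mem_iota => /andP[_ xl] ->.
all: by apply: relationE => // y; apply: branches_none.
Qed.

Lemma no_dart_system : False.
Proof. by apply: search_sound search_nil => x; rewrite /get nth_nil. Qed.
End DartSystem.

(** * Triangles in the developed lattice *)

Section Lattice.
Variables (E : finType) (L R : E -> E).
Hypothesis L3 : forall e, L (L (L e)) = e.
Hypothesis R3 : forall e, R (R (R e)) = e.

(* [L e] and [R e] follow [e] around the triangle on its left and on its right;
   [rho] turns an edge to the next one leaving the same vertex, so that the
   edges leaving a regular vertex are permuted in a 3-cycle. *)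
Definition rho e := R (L (L e)).
Definition sing e := rho (rho (rho e)) != e.
(** In the regular lattice, [east] and [north] translate an edge by its own vector and by this
    vector turned 60 degrees. *)
Definition east e := L (R (R (L e))).
Definition north e := R (L e).
Definition pos z k b := iter k east (iter b north z).

Lemma L_inj : injective L.
Proof. by move=> x y e; rewrite -(L3 x) -(L3 y) e. Qed.
Lemma R_inj : injective R.
Proof. by move=> x y e; rewrite -(R3 x) -(R3 y) e. Qed.
Lemma rho_inj : injective rho.
Proof. by move=> x y /R_inj/L_inj/L_inj. Qed.
Lemma east_inj : injective east.
Proof. by move=> x y /L_inj/R_inj/R_inj/L_inj. Qed.

Lemma sing_rho e : sing (rho e) = sing e.
Proof. by rewrite /sing (inj_eq rho_inj). Qed.
Lemma rho_east e : rho (east e) = L e.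
Proof. by rewrite /rho /east L3 R3. Qed.
Lemma sing_east e : sing (east e) = sing (L e).
Proof. by rewrite -sing_rho rho_east. Qed.
Lemma sing_north e : sing (north e) = sing (L (L e)).
Proof. by rewrite -(sing_rho (L (L e))) /rho L3. Qed.

(** The two paths differ by three turns [rho] about one vertex, the tail of [L (north e)]. *)
Lemma north_eastE e : (north (east e) == east (north e)) = ~~ sing (L (north e)).
Proof.
rewrite /sing negbK -(inj_eq rho_inj (north (east e))) rho_east.
rewrite /north /east.
have -> : rho (R (L (L (R (R (L e)))))) = rho (rho (rho (L (R (L e))))).
  by rewrite /rho !L3.
done.
Qed.

(* The white triangles of a lattice triangle of side [S] develop onto the edges
   [pos z k b] with [k + b < S], where [z] is the first edge of the base; the
   condition closes up the black triangles between them. *)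
Definition fill z S := forall k b, k + b + 2 <= S -> north (pos z k b) = pos z k b.+1.
Definition turn z S := L (pos z S.-1 0).

Lemma pos_east z k b : pos z k.+1 b = east (pos z k b). Proof. by []. Qed.

(** A white triangle has barycentric coordinates [k], [b] and [S - 1 - k - b]; turning the base
    permutes them cyclically. *)
Lemma pos_turn z S k b : fill z S -> k + b < S ->
  pos (turn z S) k b = L (pos z (S - 1 - k - b) k).
Proof.
move=> F.
have north_step k' b' : k' + b' + 2 <= S ->
    north (L (pos z (S - 1 - k' - b') k')) = L (pos z (S - 1 - k' - b'.+1) k').
  move=> H.
  have -> : S - 1 - k' - b' = (S - 1 - k' - b'.+1).+1 by lia.
  by rewrite pos_east /north /east L3 R3.
have east_step k' b' : k' + b' + 2 <= S ->
    east (L (pos z (S - 1 - k' - b') k')) = L (pos z (S - 1 - k'.+1 - b') k'.+1).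
  move=> H.
  have -> : S - 1 - k' - b' = (S - 1 - k'.+1 - b').+1 by lia.
  rewrite -F; last by lia.
  by rewrite pos_east /north /east L3 R3.
elim: k b => [|k IHk] b kbS.
  elim: b kbS => [|b IHb] bS; first by rewrite /pos /turn /= !subn0 subn1.
  by rewrite -[LHS]/(north (pos (turn z S) 0 b)) IHb ?north_step //; lia.
by rewrite pos_east IHk ?east_step //; lia.
Qed.

Lemma fill_turn z S : fill z S -> fill (turn z S) S.
Proof.
move=> F k b H; rewrite !pos_turn //; try lia.
have -> : S - 1 - k - b = (S - 1 - k - b.+1).+1 by lia.
by rewrite pos_east /north /east L3 R3.
Qed.

Lemma turn2 z S : 0 < S -> fill z S -> turn (turn z S) S = L (L (pos z 0 S.-1)).
Proof.
move=> S0 F; rewrite {1}/turn pos_turn //; last by lia.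
by congr (L (L (pos _ _ _))); lia.
Qed.

Lemma turn3 z S : 0 < S -> fill z S -> turn (turn (turn z S) S) S = z.
Proof.
move=> S0 F; rewrite turn2 //; last exact: fill_turn.
rewrite pos_turn //; last by lia.
by rewrite L3; have -> : S - 1 - 0 - S.-1 = 0 by lia.
Qed.

Lemma pos_turn2 z S k b : fill z S -> k + b < S ->
  pos (turn (turn z S) S) k b = L (L (pos z b (S - 1 - k - b))).
Proof.
move=> F H; rewrite pos_turn //; last exact: fill_turn.
rewrite pos_turn //; last by lia.
by congr (L (L (pos _ _ _))); lia.
Qed.

Lemma pos_pos z S k b k' b' : fill z S -> k + b + b' < S ->
  pos (pos z k b) k' b' = pos z (k + k') (b + b').
Proof.
move=> F H; rewrite {1}/pos.
have -> : iter b' north (pos z k b) = pos z k (b + b').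
  elim: b' H => [|b' IH] H; first by rewrite addn0.
  by rewrite iterS IH ?F ?addnS //; lia.
by rewrite -iterD addnC.
Qed.

Lemma fill_sub z S k b s : fill z S -> k + b + s <= S -> fill (pos z k b) s.
Proof.
move=> F H k' b' H'; rewrite !(pos_pos _ F); try lia.
by rewrite F ?addnS //; lia.
Qed.

Lemma fill_inner z S k b : fill z S -> k + b + 3 <= S -> ~~ sing (L (pos z k b.+1)).
Proof.
move=> F H; rewrite -F; last by lia.
by rewrite -north_eastE -pos_east F ?F //; lia.
Qed.

Lemma fill_inner_pos z S k b : fill z S -> 0 < k -> 0 < b -> k + b < S ->
  ~~ sing (pos z k b).
Proof.
case: k b => [|k] [|b] // F _ _ H; rewrite pos_east sing_east.
by apply: fill_inner F _; lia.
Qed.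

(** The new black triangles along the far side close up one by one, by [north_eastE] at the regular
    vertices inside that side. *)
Lemma fill_ext z s : fill z s ->
  (forall k, 0 < k < s -> ~~ sing (L (pos z (s - 1 - k) k))) -> fill z s.+1.
Proof.
move=> F ns; elim=> [|k IHk] b H //.
have [|lt] := leqP (k.+1 + b + 2) s; first exact: F.
have Fk := IHk b ltac:(lia).
rewrite pos_east [RHS]pos_east -Fk; apply/eqP; rewrite north_eastE Fk.
have -> : k = s - 1 - b.+1 by lia.
by apply: ns; lia.
Qed.

Lemma fill1 z : fill z 1. Proof. by move=> k b; lia. Qed.

(** * Growing triangles *)

Definition last_sing (p : nat -> E) S k :=
  [/\ k < S, sing (p k) & forall k', k < k' < S -> ~~ sing (p k')].

Lemma last_sing_uniq p S k l : last_sing p S k -> last_sing p S l -> k = l.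
Proof.
move=> [kS sk nk] [lS sl nl]; apply/eqP; rewrite eqn_leq.
apply/andP; split; rewrite leqNgt; apply/negP => H.
- by have := nl k; rewrite H kS sk => /(_ isT).
- by have := nk l; rewrite H lS sl => /(_ isT).
Qed.

Lemma last_sing_ex p S k : k < S -> sing (p k) -> exists l, last_sing p S l.
Proof.
move=> kS sk.
have ex : exists k, (k < S) && sing (p k) by exists k; rewrite kS.
have ub l : (l < S) && sing (p l) -> l <= S by case/andP => /ltnW.
case: (ex_maxnP ex ub) => l /andP[lS sl] max; exists l; split=> // l' /andP[ll' l'S].
apply/negP => sl'; have := max l'; rewrite l'S sl' => /(_ isT); lia.
Qed.

Definition front e s k := L (pos e (s - 1 - k) k).

Lemma front_turn z S k : fill z S -> k < S -> pos (turn z S) k 0 = front z S k.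
Proof. by move=> F kS; rewrite pos_turn ?addn0 // subn0. Qed.

Lemma turn_front z S : turn z S = front z S 0.
Proof. by rewrite /turn /front subn0 subn1. Qed.

Lemma sing_base z k : sing (pos z k.+1 0) = sing (front z k.+1 0).
Proof. by rewrite pos_east sing_east -turn_front. Qed.

Lemma rho_front z S k b : fill z S -> k + b + 2 <= S ->
  rho (L (pos z k b.+1)) = L (L (pos z k.+1 b)).
Proof. by move=> F H; rewrite /rho L3 -F // pos_east /east /north L3. Qed.

(* [f] leaves the first singular vertex met by the far side of the growing
   triangle with corner the tail of [e]; taking the last one on that side
   breaks ties consistently. *)
Definition hit e i j f :=
  [/\ 0 < i, fill e (i + j), last_sing (front e (i + j)) (i + j) j,
      f = front e (i + j) j &
      forall s k, k < s -> s < i + j -> ~~ sing (front e s k)].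

Lemma hit_uniq e i j f i' j' f' :
  hit e i j f -> hit e i' j' f' -> [/\ i = i', j = j' & f = f'].
Proof.
move=> [i0 F l -> n] [i0' F' l' -> n'].
have ss : i + j = i' + j'.
  apply/eqP; rewrite eqn_leq; apply/andP; split; rewrite leqNgt; apply/negP => H.
  - by case: l' => jS sj _; have := n _ _ jS H; rewrite sj.
  - by case: l => jS sj _; have := n' _ _ jS H; rewrite sj.
rewrite -ss in l'; have jj := last_sing_uniq l l'.
by subst j'; rewrite ss; split=> //; lia.
Qed.

Lemma east_return z n : exists2 k, n < k & iter k east z = z.
Proof.
exists (order east z * n.+1).
  by rewrite (leq_trans (ltnSn n)) // leq_pmull // order_gt0.
rewrite mulnC; elim: n.+1 => //= k IH.
by rewrite mulSn iterD IH iter_order //; apply: east_inj.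
Qed.

(** [east] has finite order, so the prolonged base returns to the singular vertex at [j] and the
    front meets it; up to the first size with a singular front, [fill_ext] applies. *)
Lemma grow z s j : 0 < s -> fill z s -> sing (pos z j 0) ->
  exists S, [/\ s <= S, fill z S, exists2 k, k < S & sing (front z S k) &
    forall s' k, k < s' -> s <= s' < S -> ~~ sing (front z s' k)].
Proof.
move=> s0 F sj.
pose has_front n := [exists k : 'I_(s + n), sing (front z (s + n) k)].
have [n hn] : exists n, has_front n.
  have [k ks ret] := east_return (pos z j 0) s.
  exists (k + j - s); apply/existsP.
  have lt : 0 < s + (k + j - s) by lia.
  exists (Ordinal lt) => /=.
  have -> : s + (k + j - s) = (k + j).-1.+1 by lia.
  rewrite -sing_base; have -> : (k + j).-1.+1 = k + j by lia.
  by rewrite /pos iterD ret.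
have exn : exists n, has_front n by exists n.
case: (ex_minnP exn) => {hn} {}n /existsP[k sk] min.
have ns s' l : l < s' -> s <= s' < s + n -> ~~ sing (front z s' l).
  move=> ls' /andP[ss' s'n]; apply/negP => sl.
  have /min : has_front (s' - s).
    apply/existsP; have lt : l < s + (s' - s) by lia.
    by exists (Ordinal lt) => /=; rewrite subnKC.
  lia.
exists (s + n); split=> //; first lia; last by exists (k : nat).
elim: n {k sk min exn} ns => [|n IH] ns; first by rewrite addn0.
rewrite addnS; apply: fill_ext => [|k /andP[_ kn]].
  by apply: IH => s' l ls' /andP[ss' s'n]; apply: ns => //; lia.
by apply: (ns (s + n) k) => //; lia.
Qed.

Lemma hit_ex e : sing e -> exists i j f, hit e i j f.
Proof.
move=> se; have [S [S1 F [k kS sk] ns]] := @grow e 1 0 isT (@fill1 e) se.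
have [j lj] := last_sing_ex kS sk.
have jS : j < S by case: lj.
have Sij : S = S - j + j by lia.
exists (S - j), j, (front e S j); rewrite /hit -!Sij; split=> //; first lia.
by move=> s l ls sS; apply: ns => //; lia.
Qed.

(** * Triangles inscribed in equilateral ones *)

(* An immersed triangle with a singular vertex on each side; a vertex at the far
   end of a side is counted on the next one. *)
Definition tri z S x0 x1 x2 :=
  [/\ fill z S, last_sing (fun k => pos z k 0) S x0,
      last_sing (fun k => pos (turn z S) k 0) S x1 &
      last_sing (fun k => pos (turn (turn z S) S) k 0) S x2].

Lemma tri_turn z S x0 x1 x2 : tri z S x0 x1 x2 -> tri (turn z S) S x1 x2 x0.
Proof.
move=> [F l0 l1 l2]; have S0 : 0 < S by case: l0; lia.
by split=> //; [exact: fill_turn | rewrite turn3].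
Qed.

Lemma tri_hit z S x0 x1 x2 : tri z S x0 x1 x2 -> x0 + x1 < S ->
  hit (pos z x0 0) (S - x0 - x1) x1 (pos (turn z S) x1 0).
Proof.
move=> [F [x0S s0 n0] [x1S s1 n1] _] lt.
have s_eq : S - x0 - x1 + x1 = S - x0 by lia.
have frontE s k : k < s -> s <= S - x0 -> front (pos z x0 0) s k = L (pos z (x0 + (s - 1 - k)) k).
  by move=> ks sS; rewrite /front (pos_pos _ F) ?add0n //; lia.
have frontE' k : k < S - x0 -> front (pos z x0 0) (S - x0) k = pos (turn z S) k 0.
  move=> kS; rewrite frontE // front_turn //; last lia.
  by congr (L (pos _ _ _)); lia.
rewrite /hit s_eq; split.
- lia.
- by apply: fill_sub F _; lia.
- split; [lia | by rewrite frontE' //; lia |].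
  by move=> k kS; rewrite frontE' ?n1 //; lia.
- by rewrite frontE' //; lia.
- move=> s [|k] ks sS; rewrite frontE ?(ltnW sS) //.
    rewrite -sing_east -pos_east; apply: n0; lia.
  by apply: fill_inner F _; lia.
Qed.

(** The triangle of side [x1] at the right-hand corner, seen from its top, has the singular vertex
    of the base on its far side. Ties [x0 + x1 = S] fall here. *)
Lemma tri_hit_back z S x0 x1 x2 : tri z S x0 x1 x2 -> S <= x0 + x1 ->
  hit (rho (pos (turn z S) x1 0)) (S - x0) (x0 + x1 - S) (pos z x0 0).
Proof.
move=> [F [x0S s0 n0] [x1S s1 n1] _] le.
have s_eq : S - x0 + (x0 + x1 - S) = x1 by lia.
set u := pos z (S - x1) 0.
have Fu : fill u x1 by apply: fill_sub F _; lia.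
have x1_gt0 : 0 < x1 by lia.
have rhoE : rho (pos (turn z S) x1 0) = turn (turn u x1) x1.
  rewrite turn2 // /u (pos_pos _ F); last lia.
  rewrite front_turn // /front addn0 add0n.
  have -> : pos z (S - 1 - x1) x1 = pos z (S - 1 - x1) x1.-1.+1 by congr pos; lia.
  rewrite (rho_front F); last lia.
  by congr (L (L (pos _ _ _))); lia.
set w := turn (turn u x1) x1.
have Fw : fill w x1 by do 2!apply: fill_turn.
have frontE s k : k < s -> s <= x1 -> front w s k = pos z (S - x1 + k) (x1 - s).
  move=> ks sx; rewrite /front pos_turn2 //; last lia.
  rewrite L3 /u (pos_pos _ F); last lia.
  by congr (pos _ _ _); lia.
rewrite rhoE -/w /hit s_eq; split=> //.
- lia.
- split; [lia | rewrite frontE //; last lia |].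
    have -> : S - x1 + (x0 + x1 - S) = x0 by lia.
    by rewrite subnn.
  move=> k kS; rewrite frontE ?subnn //; [apply: n0 |]; lia.
- rewrite frontE // ?subnn; last lia.
  by congr pos; lia.
- by move=> s k ks sx; rewrite frontE ?(ltnW sx) //; apply: fill_inner_pos F _ _ _; lia.
Qed.

(** Both triangles share the right-hand corner; were the first smaller, its third singular vertex
    would lie inside the other or on its right side beyond [x1]. *)
Lemma tri_uniq_le z S x0 x1 x2 z' S' x0' x2' :
  tri z S x0 x1 x2 -> tri z' S' x0' x1 x2' ->
  pos z x0 0 = pos z' x0' 0 -> S - x0 = S' - x0' -> S <= S' ->
  [/\ z = z', S = S', x0 = x0' & x2 = x2'].
Proof.
move=> [F [x0S s0 n0] [x1S s1 n1] l2] [F' [x0S' s0' n0'] [x1S' s1' n1'] l2'] ee ss le.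
have ze : z = pos z' (S' - S) 0.
  have : iter x0 east z = iter x0 east (pos z' (S' - S) 0).
    by rewrite -[LHS]/(pos z x0 0) ee /pos -iterD; congr iter; lia.
  by elim: (x0) => //= k IH /east_inj.
have [SS|lt] := leqP S' S.
  have {le SS} Se : S = S' by lia.
  subst S'; have xx : x0 = x0' by lia.
  rewrite subnn in ze; have {ze}zz : z = z' by [].
  by subst; split=> //; apply: last_sing_uniq l2 l2'.
case: l2 => x2S; rewrite pos_turn2 ?addn0 // subn0 => s2 _; exfalso; apply/negP: s2.
rewrite ze (pos_pos _ F'); last lia.
rewrite add0n addn0; case: x2 x2S => [|x2] x2S.
  have -> : L (L (pos z' (S' - S) (S - 1 - 0))) = rho (front z' S' S).
    have {3}-> : S = (S - 1 - 0).+1 by lia.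
    rewrite /front (rho_front F'); last lia.
    by congr (L (L (pos _ _ _))); lia.
  by rewrite sing_rho -front_turn // n1' //; lia.
by rewrite -sing_north F' ?(fill_inner_pos F') //; lia.
Qed.

Lemma tri_uniq z S x0 x1 x2 z' S' x0' x2' :
  tri z S x0 x1 x2 -> tri z' S' x0' x1 x2' ->
  pos z x0 0 = pos z' x0' 0 -> S - x0 = S' - x0' ->
  [/\ z = z', S = S', x0 = x0' & x2 = x2'].
Proof.
move=> t t' ee ss; have [le|/ltnW le] := leqP S S'; first exact: tri_uniq_le t t' ee ss le.
by case: (tri_uniq_le t' t (esym ee) (esym ss) le).
Qed.

(* Both kinds of triangle below arise by enlarging a given one away from a
   fixed side; that side is made the base, so that the growing side is the
   front. *)
Lemma hit_tri e i j f : sing e -> hit e i j f ->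
  exists z S x0 x2, [/\ tri z S x0 j x2, pos z x0 0 = e & S - x0 = i + j].
Proof.
move=> se [i0 F l fE ns]; set s := i + j in F l fE ns *.
have [js sj nj] := l; have s0 : 0 < s by lia.
set z := turn e s; have Fz : fill z s by apply: fill_turn.
have szj : sing (pos z j 0) by rewrite front_turn.
have [S [sS FS [k kS sk] nS]] := grow s0 Fz szj.
have [x2 l2] : exists x2, last_sing (fun k => pos (turn z S) k 0) S x2.
  by apply: (@last_sing_ex _ _ k); rewrite ?front_turn.
have leftE k' : S - s <= k' -> k' < S ->
    pos (turn (turn z S) S) k' 0 = pos e (k' - (S - s)) 0.
  move=> lek ltk; rewrite pos_turn2 ?addn0 // subn0.
  have -> : S - 1 - k' = s - 1 - (k' - (S - s)) by lia.
  have := @pos_turn2 z s (k' - (S - s)) 0 Fz.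
  by rewrite addn0 subn0 turn3 // => <- //; lia.
have t : tri z S j x2 (S - s).
  split=> //.
  - split; first lia; first by [].
    move=> k' /andP[jk k'S]; have [sk'|k's] := leqP s k'.
      have -> : k' = k'.-1.+1 by lia.
      by rewrite sing_base; apply: nS; lia.
    by rewrite front_turn // nj // jk.
  - split; [lia | by rewrite leftE ?subnn //; lia |].
    move=> k' /andP[lk k'S]; rewrite leftE //; last lia.
    have -> : k' - (S - s) = (k' - (S - s)).-1.+1 by lia.
    by rewrite sing_base; apply: ns; lia.
exists (turn (turn z S) S), S, (S - s), x2; split; last lia.
- exact: tri_turn (tri_turn t).
- by rewrite leftE ?subnn //; lia.
Qed.

Lemma hit_back_tri g i j e : sing g -> hit g i j e ->
  exists z S x0 x1 x2, [/\ tri z S x0 x1 x2, pos z x0 0 = e, S <= x0 + x1 &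
    rho (pos (turn z S) x1 0) = g].
Proof.
move=> sg [i0 F l fE ns]; set s := i + j in F l fE ns *.
have [js sj nj] := l; have s0 : 0 < s by lia.
set u := turn g s; have Fu : fill u s by apply: fill_turn.
have ue : pos u j 0 = e by rewrite front_turn.
set z := turn u s; have Fz : fill z s by apply: fill_turn.
have zg : turn z s = g by rewrite turn3.
(* One more row is needed: the tail of [g] is at position [s] on the base, which must be less than
   the side. *)
have Fz1 : fill z s.+1.
  apply: fill_ext => // k /andP[k0 ks]; rewrite -/(front z s k) -front_turn // zg.
  case: k k0 ks => // k _ ks.
  by rewrite sing_base; apply: ns; lia.
have rz : rho (pos z s 0) = g.
  rewrite -zg turn_front; have -> : s = s.-1.+1 by lia.
  by rewrite pos_east rho_east -turn_front.
have sz : sing (pos z s 0) by rewrite -sing_rho rz.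
have [S [sS FS [k kS sk] nS]] := grow (ltn0Sn s) Fz1 sz.
have [x2 l2] : exists x2, last_sing (fun k => pos (turn z S) k 0) S x2.
  by apply: (@last_sing_ex _ _ k); rewrite ?front_turn.
have leftE k' : S - s <= k' -> k' < S ->
    pos (turn (turn z S) S) k' 0 = pos u (k' - (S - s)) 0.
  move=> lek ltk; rewrite pos_turn2 ?addn0 // subn0.
  have -> : S - 1 - k' = s - 1 - (k' - (S - s)) by lia.
  have := @pos_turn2 z s (k' - (S - s)) 0 Fz.
  by rewrite addn0 subn0 turn3 // => <- //; lia.
have t : tri z S s x2 (S - s + j).
  split=> //.
  - split=> // k' /andP[sk' k'S]; have -> : k' = k'.-1.+1 by lia.
    by rewrite sing_base; apply: nS; lia.
  - split; first lia.
      by rewrite leftE ?addKn ?ue ?fE //; lia.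
    move=> k' /andP[lk k'S]; rewrite leftE ?front_turn ?nj //; lia.
exists (turn (turn z S) S), S, (S - s + j), s, x2; split; last first.
- by rewrite turn3 //; lia.
- lia.
- by rewrite leftE ?addKn //; lia.
- exact: tri_turn (tri_turn t).
Qed.

(** * The dart system of the two singular vertices *)

Section Obstruction.
Hypothesis L_neq : forall e, L e != e.
Hypothesis R_neq : forall e, R e != e.
Hypothesis rho_neq : forall e, rho e != e.

(* A triangle equal to its rotation has a fixed centre: a fixed white
   triangle, a fixed black one or a fixed vertex, according to S mod 3. *)
Lemma turn_neq z S : 0 < S -> fill z S -> turn z S != z.
Proof.
move=> S0 F; apply/eqP => tz.
have posE k b : k + b < S -> pos z k b = L (pos z (S - 1 - k - b) k).
  by move=> H; rewrite -pos_turn // tz.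
have [m Sm] : exists m, S = 3 * m + 1 \/ S = 3 * m + 2 \/ S = 3 * m + 3.
  by exists ((S - 1) %/ 3); lia.
case: Sm => [Sm|[Sm|Sm]].
- have := posE m m; have -> : S - 1 - m - m = m by lia.
  by move=> H; have := L_neq (pos z m m); rewrite -H ?eqxx; lia.
- have := posE m m.+1; have -> : S - 1 - m - m.+1 = m by lia.
  rewrite -F; last lia.
  by move=> H; have := R_neq (L (pos z m m)); rewrite -/(north _) H ?eqxx; lia.
- have := posE m.+1 m.+1; have -> : S - 1 - m.+1 - m.+1 = m by lia.
  move=> H; have := rho_neq (L (pos z m m.+1)).
  by rewrite -H ?pos_east ?rho_east -?pos_east ?H ?eqxx; lia.
Qed.

Variables p q : E.
Hypothesis rho2p : rho (rho p) = p.
Hypothesis rho4q : rho (rho (rho (rho q))) = q.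
Hypothesis rho2q : rho (rho q) != q.
Let outs := [:: p; rho p; q; rho q; rho (rho q); rho (rho (rho q))].
Hypothesis sing_outs : forall e, sing e -> e \in outs.

Let outs_sing e : e \in outs -> sing e.
Proof.
have sp : sing p by rewrite /sing rho2p.
have sq : sing q.
  apply: contraNneq rho2q => q3; apply/eqP.
  by have := rho4q; rewrite q3 => q1; rewrite !q1.
by rewrite !inE; do 5?[case/orP]; move=> /eqP->; rewrite ?sing_rho.
Qed.

Let iter_rho_inj k : injective (iter k rho).
Proof. by elim: k => //= k IH x y /rho_inj/IH. Qed.

Let outs_uniq : uniq outs.
Proof.
have pq k : p != iter k rho q.
  apply: contraNneq rho2q => pE.
  have : iter k rho (rho (rho q)) = iter k rho q.
    by rewrite -pE -rho2p pE -!iterS -!iterSr.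
  by move=> /eqP; rewrite (inj_eq (@iter_rho_inj k)).
have rpq k : rho p != iter k rho q.
  by apply: contraNneq (pq k.+1) => pE; rewrite iterS -pE rho2p.
have q13 : q != rho (rho (rho q)).
  by apply: contraNneq (rho_neq q) => qE; rewrite {1}qE rho4q.
rewrite /= !inE !negb_or (pq 0) (pq 1) (pq 2) (pq 3).
rewrite (rpq 0) (rpq 1) (rpq 2) (rpq 3) !(inj_eq rho_inj) q13.
by rewrite ![_ == rho _]eq_sym !rho_neq rho2q.
Qed.

Let out k := nth p outs k.
Let idx e := index e outs.

Let idx_lt e : sing e -> idx e < 6.
Proof. by move=> /sing_outs; rewrite -index_mem. Qed.
Let out_sing k : k < 6 -> sing (out k).
Proof. by move=> k6; apply/outs_sing/mem_nth. Qed.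
Let outK k : k < 6 -> idx (out k) = k.
Proof. by move=> k6; apply: index_uniq. Qed.
Let idxK e : sing e -> out (idx e) = e.
Proof. by move=> /sing_outs; apply: nth_index. Qed.

Let idx_rho e : sing e -> idx (rho e) = next_out (idx e).
Proof.
move=> se; rewrite -{1}(idxK se).
have <- : out (next_out (idx e)) = rho (out (idx e)).
  by case: (idx e) (idx_lt se) => [|[|[|[|[|[|k]]]]]] //= _; rewrite /out /= ?rho2p ?rho4q.
by apply: outK; case: (idx e) (idx_lt se) => [|[|[|[|[|[|k]]]]]].
Qed.

(** A Delaunay triangle with a marked corner, given by its circumscribed equilateral triangle. *)
Record config := Config { cbase : E; csize : nat; pos0 : nat; pos1 : nat; pos2 : nat }.
Let valid d := tri (cbase d) (csize d) (pos0 d) (pos1 d) (pos2 d).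
Let rot d := Config (turn (cbase d) (csize d)) (csize d) (pos1 d) (pos2 d) (pos0 d).
Let apex d := pos (cbase d) (pos0 d) 0.
Let forward d := pos0 d + pos1 d < csize d.
(* The right-hand edge of the corner of [d] at its bottom vertex: the segment
   leaving that vertex, or one arriving there from the right-hand vertex. *)
Let dart d := if forward d then idx (apex d) else idx (rho (apex (rot d))) + 6.

Let valid_rot d : valid d -> valid (rot d). Proof. exact: tri_turn. Qed.
Let apex_sing d : valid d -> sing (apex d). Proof. by case=> _ []. Qed.
Let pos0_lt d : valid d -> pos0 d < csize d. Proof. by case=> _ []. Qed.

Let rot3 d : valid d -> rot (rot (rot d)) = d.
Proof.
move=> v; have := pos0_lt v; case: d v => z S x0 x1 x2 [F _ _ _] /= xS.
by rewrite /rot /= turn3 //; lia.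
Qed.

Let rot2_neq d : valid d -> rot (rot d) <> d.
Proof.
move=> v dd; have := rot3 v; rewrite dd => /(congr1 cbase) /= tz.
have S0 : 0 < csize d by have := pos0_lt v; lia.
by have [F _ _ _] := v; have := turn_neq S0 F; rewrite tz eqxx.
Qed.

Let hit_forward d : valid d -> forward d ->
  hit (apex d) (csize d - pos0 d - pos1 d) (pos1 d) (apex (rot d)).
Proof. exact: tri_hit. Qed.

Let hit_backward d : valid d -> ~~ forward d ->
  hit (rho (apex (rot d))) (csize d - pos0 d) (pos0 d + pos1 d - csize d) (apex d).
Proof. by move=> v; rewrite /forward -leqNgt; apply: tri_hit_back v. Qed.

Let rho_apex_sing d : valid d -> sing (rho (apex (rot d))).
Proof. by move=> /valid_rot/apex_sing; rewrite sing_rho. Qed.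

Let forward_dart d : valid d -> forward d = (dart d < 6).
Proof.
rewrite /dart => v; case: ifP => _; last by lia.
by rewrite idx_lt // apex_sing.
Qed.

Let dart_lt d : valid d -> dart d < 12.
Proof.
move=> v; rewrite /dart; have := idx_lt (apex_sing v); have := idx_lt (rho_apex_sing v).
by case: ifP; lia.
Qed.

Let idx_inj e e' : sing e -> sing e' -> idx e = idx e' -> e = e'.
Proof. by move=> se se' ee; rewrite -(idxK se) ee idxK. Qed.

(** A dart fixes its segment by [hit_uniq], and the segment fixes the triangle beside it by
    [tri_uniq]. *)
Let dart_inj d d' : valid d -> valid d' -> dart d = dart d' -> d = d'.
Proof.
move=> v v' dd.
have ff : forward d = forward d' by rewrite !forward_dart // dd.
suff [aa ss xx] : [/\ apex d = apex d', csize d - pos0 d = csize d' - pos0 d' & pos1 d = pos1 d'].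
  move: v v' aa ss xx {dd ff}; case: d => z S x0 x1 x2; case: d' => z' S' x0' x1' x2'.
  rewrite /valid /apex /= => v v' aa ss xx; subst x1'.
  by have [-> -> -> ->] := tri_uniq v v' aa ss.
have lt := pos0_lt v; have lt' := pos0_lt v'.
move: dd; rewrite /dart -ff; case: ifP => fd.
  move/(idx_inj (apex_sing v) (apex_sing v')) => aa.
  have := hit_forward v' _; rewrite -ff -aa => /(_ fd) h.
  have [ii jj _] := hit_uniq (hit_forward v fd) h.
  by move: fd ff; rewrite /forward; split=> //; lia.
move/addIn/(idx_inj (rho_apex_sing v) (rho_apex_sing v')) => aa.
have := hit_backward v' _; rewrite -ff -aa fd => /(_ isT) h.
have [ii jj ee] := hit_uniq (hit_backward v (negbT fd)) h.
by move: fd ff; rewrite /forward; split=> //; lia.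
Qed.

Let dart_surj x : x < 12 -> exists d, valid d /\ dart d = x.
Proof.
have [x6 _|x6 x12] := ltnP x 6.
  have so := out_sing x6; have [i [j [f h]]] := hit_ex so.
  have [z [S [x0 [x2 [t ze Ss]]]]] := hit_tri so h.
  exists (Config z S x0 j x2); split=> //.
  rewrite /dart /forward /apex /= ze outK //. rewrite ifT //.
  by case: h => i0 _ _ _ _; lia.
have x6' : x - 6 < 6 by lia.
have so := out_sing x6'; have [i [j [f h]]] := hit_ex so.
have [z [S [x0 [x1 [x2 [t ze Ss rz]]]]]] := hit_back_tri so h.
exists (Config z S x0 x1 x2); split=> //.
by rewrite /dart /forward /apex /= rz outK // ifF; lia.
Qed.

Lemma no_lattice : False.
Proof.
have [tr trP] := finite_choice (Config p 0 0 0 0) dart_surj.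
have [ij ijP] : exists ij : nat -> nat * nat, forall k, k < 6 ->
    exists f, hit (out k) (ij k).1 (ij k).2 f.
  apply: (@finite_choice _ (0, 0) (fun k ij => exists f, hit (out k) ij.1 ij.2 f)).
  by move=> k /out_sing/hit_ex[i [j [f h]]]; exists (i, j), f.
have trv x : x < 12 -> valid (tr x) by case/trP.
have trK x : x < 12 -> dart (tr x) = x by case/trP.
have dartK d : valid d -> tr (dart d) = d.
  by move=> v; apply: dart_inj => //; [apply: trv | rewrite trK //]; apply: dart_lt.
(* Turning back once in the triangle gives the left-hand edge of the corner, seen from its far end;
   [rev_dart] brings it to the corner. *)
pose nx x := rev_dart (dart (rot (rot (tr x)))).
pose sec x := idx (apex (tr x)).
have revK x : x < 12 -> rev_dart (rev_dart x) = x.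
  by rewrite /rev_dart => xl; case: (ltnP x 6) => x6; case: ifP; lia.
have rev_lt x : x < 12 -> rev_dart x < 12.
  by rewrite /rev_dart => xl; case: ifP; lia.
have v2 x : x < 12 -> valid (rot (rot (tr x))) by move=> /trv v; do 2!apply: valid_rot.
have GE x : x < 12 -> rev_dart (nx x) = dart (rot (rot (tr x))).
  by move=> xl; apply/revK/dart_lt/v2.
have hit_out k i j f : k < 6 -> hit (out k) i j f -> i = (ij k).1 /\ j = (ij k).2.
  by move=> k6 h; have [f' h'] := ijP _ k6; case: (hit_uniq h h').
have hit_idx e i j f : sing e -> hit e i j f -> i = (ij (idx e)).1 /\ j = (ij (idx e)).2.
  by move=> se h; apply: (hit_out _ _ _ f); rewrite ?idx_lt ?idxK.
pose i k := (ij k).1; pose j k := (ij k).2.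
pose c x := if x < 6 then i x + j x else i (x - 6).
pose d x := if x < 6 then i x + j x else j (x - 6).
(* The apex splits the base in two: [c x] is the right-hand part, [d (nx x)] the left-hand one. *)
have cE x : x < 12 -> c x = csize (tr x) - pos0 (tr x).
  move=> xl; have v := trv _ xl; have := trK _ xl; rewrite /c.
  have [f|f] := boolP (forward (tr x)); rewrite /dart ?f ?(negbTE f) => xE.
    have [/esym e1 /esym e2] := hit_idx _ _ _ _ (apex_sing v) (hit_forward v f).
    rewrite -xE idx_lt ?apex_sing // xE /i /j; rewrite xE in e1 e2; rewrite e1 e2.
    by move: f; rewrite /forward; lia.
  have [/esym e1 _] := hit_idx _ _ _ _ (rho_apex_sing v) (hit_backward v f).
  by rewrite ifF; [rewrite -e1; congr (ij _).1; lia | lia].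
have nx_fwd x : x < 12 -> forward (rot (rot (tr x))) ->
    nx x = idx (apex (rot (rot (tr x)))) + 6.
  by move=> xl f; rewrite /nx /dart f /rev_dart ifT //; apply/idx_lt/apex_sing/v2.
have nx_bwd x : x < 12 -> ~~ forward (rot (rot (tr x))) -> nx x = idx (rho (apex (tr x))).
  move=> xl /negbTE f; rewrite /nx /dart f rot3; last exact: trv.
  by rewrite /rev_dart ifF ?addnK //; lia.
have rho_lt x : x < 12 -> idx (rho (apex (tr x))) < 6.
  by move=> /trv/apex_sing; rewrite -sing_rho => /idx_lt.
have dE x : x < 12 -> d (nx x) = pos0 (tr x).
  move=> xl; have v := v2 _ xl; rewrite /d.
  have [f|f] := boolP (forward (rot (rot (tr x)))).
    rewrite nx_fwd // ifF ?addnK; last by lia.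
    by have [_ /esym] := hit_idx _ _ _ _ (apex_sing v) (hit_forward v f).
  have [/esym e1 /esym e2] := hit_idx _ _ _ _ (rho_apex_sing v) (hit_backward v f).
  rewrite nx_bwd // ifT ?rho_lt //; rewrite rot3 in e1 e2; last exact: trv.
  move: f e1 e2 (pos0_lt v); rewrite /forward /i /j /=; lia.
have tr_G x : x < 12 -> tr (rev_dart (nx x)) = rot (rot (tr x)).
  by move=> xl; rewrite GE // dartK //; apply: v2.
have G_lt x : x < 12 -> rev_dart (nx x) < 12.
  by move=> xl; rewrite GE //; apply/dart_lt/v2.
apply: (@no_dart_system nx sec i j).
- by move=> x xl; apply/rev_lt/dart_lt/v2.
- move=> e e6; have el : e < 12 by lia.
  have v := trv _ el; have f : forward (tr e) by rewrite forward_dart // trK.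
  by have := trK _ el; rewrite /dart f.
- move=> x xl; have [f|f] := boolP (forward (rot (rot (tr x)))); first by rewrite nx_fwd //; lia.
  by move=> _; rewrite nx_bwd // idx_rho //; apply/apex_sing/trv.
- move=> x xl; have [f _|f] := boolP (forward (rot (rot (tr x)))); last first.
    by rewrite nx_bwd // leqNgt rho_lt.
  have v := v2 _ xl; have sg := apex_sing v; have g6 := idx_lt sg.
  rewrite nx_fwd //; set g := apex _ in f sg g6 *.
  have yl : idx g + 6 < 12 by lia.
  have v' := trv _ yl; have f' : ~~ forward (tr (idx g + 6)) by rewrite forward_dart // trK //; lia.
  have := trK _ yl; rewrite {1}/dart (negbTE f') => /addIn.
  move/(idx_inj (rho_apex_sing v') sg) => gE.
  have h := hit_backward v' f'; rewrite gE in h.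
  have [_ _] := hit_uniq h (hit_forward v f).
  by rewrite rot3 /sec => [->|]; last exact: trv.
- move=> x xl; have yl := G_lt _ xl; have zl := G_lt _ yl.
  have v := trv _ xl; rewrite [LHS]GE // !tr_G // !rot3 ?trK //.
  all: do ?apply: valid_rot => //.
- move=> x xl; apply/eqP => xx; apply: (rot2_neq (trv _ xl)).
  by rewrite -tr_G // xx.
- by move=> e e6; have [f []] := ijP _ e6.
- move=> x xl; have yl := G_lt _ xl; rewrite -/(c x) -/(d (nx x)) -/(c _) -/(d (nx (rev_dart _))).
  rewrite !cE // !dE // tr_G //=.
  by have := pos0_lt (trv _ xl); have := pos0_lt (v2 _ xl) => /=; lia.
Qed.
End Obstruction.
End Lattice.

(** * The triangulation on the black vertices *)

Theorem theorem3 (D : finType) (m : cmap D) :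
  on_torus m -> hexangulation m -> deg_2_4 m -> ~ bipartite m.
Proof.
move=> _ hex [v2 [v4 [d2 d4 d3]]] [c [cs ca]].
pose a := alpha m; pose s := sigma m.
have aK : involutive a := @alpha_invol _ m.
have s_inj : injective s := @sigma_inj _ m.
have {}ca x : c (a x) = ~~ c x by have := ca x; case: (c _); case: (c _).
have c_conn x y : fconnect s x y -> c y = c x.
  by move=> /iter_findex <-; elim: findex => //= k <-; rewrite cs.
(* Counting edges at the vertices of either colour modulo 3. *)
have cc : c v2 = c v4.
  apply/eqP; apply: contraT => neq.
  have cl b : fclosed s [pred x | c x == b] by move=> x y /eqP <-; rewrite !inE cs.
  have [k2 e2] : exists k, #|[pred x | c x == c v2]| = 2 + k * 3.
    have := @card_closed_order _ _ s_inj _ v2 3 (cl (c v2)); rewrite inE -/(vdeg m v2) d2.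
    by apply=> // x; rewrite inE => /eqP cx; case: (d3 x) => [o3|[vx|vx]];
      [right | left | case/eqP: neq; rewrite -cx; apply: c_conn].
  have [k4 e4] : exists k, #|[pred x | c x == c v4]| = 4 + k * 3.
    have := @card_closed_order _ _ s_inj _ v4 3 (cl (c v4)); rewrite inE -/(vdeg m v4) d4.
    by apply=> // x; rewrite inE => /eqP cx; case: (d3 x) => [o3|[vx|vx]];
      [right | case/eqP: neq; rewrite -cx; apply/esym/c_conn | left].
  have : #|[pred x | c x == c v2]| = #|[pred x | c x == c v4]|.
    rewrite -(card_image (inv_inj aK)); apply: eq_card => x.
    rewrite -[x in LHS]aK (mem_image (inv_inj aK)) !inE ca.
    by move: neq; case: (c v2); case: (c v4); case: (c x).
  by rewrite e2 e4; lia.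
have white3 x : c x != c v2 -> s (s (s x)) = x.
  move=> cx; have o3 : order s x = 3.
    case: (d3 x) => [//|[] /c_conn cx'].
      by rewrite cx' eqxx in cx.
    by rewrite cx' cc eqxx in cx.
  by have := iter_order s_inj x; rewrite o3.
have s_neq x : s x != x.
  apply/eqP => sx; have := order_fix sx.
  have fix_conn v : fconnect s v x -> v = x.
    by rewrite (fconnect_sym s_inj) => /iter_findex <-; elim: findex => //= k ->.
  case: (d3 x) => [|[] /fix_conn vx]; rewrite -?vx.
  - by rewrite /vdeg -/s => ->.
  - by rewrite -/(vdeg m v2) d2.
  - by rewrite -/(vdeg m v4) d4.
(* A dart at a black vertex stands for the edge with its white end on the left; [l] turns around
   that white vertex, [r] goes two steps along a hexagon. *)
pose E := {x : D | c x == c v2}.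
pose l x := a (s (a x)); pose r x := s (a (s (a x))).
have lP (e : E) : c (l (val e)) == c v2 by rewrite /l ca cs ca negbK (valP e).
have rP (e : E) : c (r (val e)) == c v2 by rewrite /r cs ca cs ca negbK (valP e).
pose L (e : E) : E := Sub (l (val e)) (lP e).
pose R (e : E) : E := Sub (r (val e)) (rP e).
have a_white (e : E) : c (a (val e)) != c v2.
  by rewrite ca (eqP (valP e)); case: (c v2).
have rhoE (e : E) : val (rho L R e) = s (val e).
  by rewrite /rho /= /r /l !aK white3 ?aK ?a_white.
have face6 x : s (a (s (a (s (a (s (a (s (a (s (a x))))))))))) = x.
  have f_inj : injective (face_perm m) by move=> y z /s_inj/(inv_inj aK).
  by have := iter_order f_inj x; rewrite -/(flen m x) hex.
have iter_conn v x n : fconnect s v x -> order s v = n -> exists2 k, k < n & x = iter k s v.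
  by move=> vx <-; exists (findex s v x); rewrite ?findex_max ?iter_findex.
have cv2 : c v2 == c v2 by []; have cv4 : c v4 == c v2 by rewrite cc.
pose p : E := Sub v2 cv2; pose q : E := Sub v4 cv4.
apply: (@no_lattice E L R _ _ _ _ _ p q).
- by move=> e; apply: val_inj; rewrite /= /l !aK white3 ?aK ?a_white.
- by move=> e; apply: val_inj; rewrite /= /r face6.
- move=> e; apply/eqP => /(congr1 val)/= /(congr1 a); rewrite /l aK => /eqP.
  by rewrite (negbTE (s_neq _)).
- move=> e; apply/eqP => /(congr1 val)/= re.
  have := @order_fix2 _ (face_perm m) _ re; by rewrite -/(flen m _) hex.
- by move=> e; apply/eqP => /(congr1 val); rewrite rhoE => /eqP; rewrite (negbTE (s_neq _)).
- by apply: val_inj; rewrite !rhoE /=; have := iter_order s_inj v2; rewrite -/(vdeg m v2) d2.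
- by apply: val_inj; rewrite !rhoE /=; have := iter_order s_inj v4; rewrite -/(vdeg m v4) d4.
- apply/eqP => /(congr1 val); rewrite !rhoE /= => /order_fix2; by rewrite -/(vdeg m v4) d4.
move=> e; rewrite /sing -val_eqE !rhoE => se.
have : fconnect s v2 (val e) \/ fconnect s v4 (val e).
  case: (d3 (val e)) => // o3; case/eqP: se.
  by have := iter_order s_inj (val e); rewrite -/(vdeg m _) o3.
rewrite !inE -!val_eqE !rhoE /=; case=> [/iter_conn/(_ d2)|/iter_conn/(_ d4)] [k kn ->].
  by case: k kn => [|[|]] //= _; rewrite eqxx ?orbT.
by case: k kn => [|[|[|[|]]]] //= _; rewrite eqxx ?orbT.
Qed.
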